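(* Let $K=\mathbb{F}_q$ be a finite field, let $\mathbb{X}=\{[P_1],\ldots,[P_m]\}$ be a nonempty subset of $\mathbb{P}^{s-1}$ with $m=|\mathbb{X}|$, where each $P_i\in K^s$ has first non-zero entry equal to $1$, and let $k\geq 1$, $d\geq 1$ be integers. Let $M_1,\ldots,M_N$, $N=\binom{k+s-1}{s-1}$, be the monomials of degree $k$ in $K[t_1,\ldots,t_s]$, let $Q_i=(M_1(P_i),\ldots,M_N(P_i))$, and let $f_1,\ldots,f_m\in K[y_1,\ldots,y_N]_d$ be homogeneous polynomials of degree $d$ with $f_i(Q_i)\neq 0$ for all $i$. Let $$C_{\mathbb{X}}(kd)=\{(g(P_1),\ldots,g(P_m)) : g\in K[t_1,\ldots,t_s]_{kd}\}$$ and $$C_{\rho_k(\mathbb{X})}(d)=\left\{\left(\tfrac{f(Q_1)}{f_1(Q_1)},\ldots,\tfrac{f(Q_m)}{f_m(Q_m)}\right) : f\in K[y_1,\ldots,y_N]_d\right\},$$ and let $C^{\perp}_{\mathbb{X}}(kd)$ and $C^{\perp}_{\rho_k(\mathbb{X})}(d)$ be their dual codes. Then $C^{\perp}_{\rho_k(\mathbb{X})}(d)$ and $C^{\perp}_{\mathbb{X}}(kd)$ are equivalent codes, and $$C^{\perp}_{\rho_k(\mathbb{X})}(d)=\lambda\cdot C^{\perp}_{\mathbb{X}}(kd),$$ where $\lambda=(\lambda_1,\ldots,\lambda_m)$ with $\lambda_i=f_i(Q_i)$ for all $i=1,\ldots,m$.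
   Context: Let $K=\mathbb{F}_q$ and let $\mathbb{P}^{s-1}$ be the projective space over $K$. For a polynomial ring $A$ over $K$ with the standard grading, $A_e$ denotes its homogeneous part of degree $e$. The $k$-th Veronese embedding is $\rho_k\colon\mathbb{P}^{s-1}\to\mathbb{P}^{N-1}$, $[x]\mapsto[(M_1(x),\ldots,M_N(x))]$; it is injective, so $\rho_k(\mathbb{X})=\{[Q_1],\ldots,[Q_m]\}$ has $m$ points. The codes $C_{\mathbb{X}}(kd)$ and $C_{\rho_k(\mathbb{X})}(d)$ displayed in the claim are the Reed--Muller-type codes of degree $kd$ on $\mathbb{X}$ and of degree $d$ on $\rho_k(\mathbb{X})$, respectively. The dual of a linear code $C\subset K^m$ is $C^{\perp}=\{b\in K^m : \sum_{i=1}^m b_ic_i=0\ \ \forall\, c\in C\}$. For $\lambda\in(K^* )^m$ and $C\subset K^m$, $\lambda\cdot C=\{(\lambda_1a_1,\ldots,\lambda_ma_m) : (a_1,\ldots,a_m)\in C\}$. Two linear codes $C,C'\subset K^m$ are called equivalent if $C'=\mu\cdot C$ for some $\mu\in(K^* )^m$. *)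

(* Defs.v *)
From HB Require Import structures.
From mathcomp Require Import all_boot all_order all_algebra.
From mathcomp Require Import boolp.
From mathcomp Require Import mpoly.

Set Implicit Arguments.
Unset Strict Implicit.
Unset Printing Implicit Defensive.

Import GRing.Theory.
Local Open Scope ring_scope.

Section Projective.

Variables (K : finFieldType) (s : nat).

(* [x] is represented by the set of nonzero scalar multiples of x. *)
Definition proj_point (x : 'rV[K]_s) : {set 'rV[K]_s} :=
  [set a *: x | a : K & a != 0].

Definition proj_space : {set {set 'rV[K]_s}} :=
  [set proj_point x | x : 'rV[K]_s & x != 0].

Definition first_nonzero_entry_is_one (x : 'rV[K]_s) : Prop :=
  exists2 i : 'I_s, x 0 i = 1 & forall j : 'I_s, (j < i)%N -> x 0 j = 0.

End Projective.

Section Veronese.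

Variables (K : finFieldType) (s N : nat).

Definition enumerates_monomials (k : nat) (M : 'I_N -> 'X_{1..s}) : Prop :=
  injective M /\ forall u : 'X_{1..s}, mdeg u = k <-> exists j, M j = u.

Definition veronese (M : 'I_N -> 'X_{1..s}) (x : 'rV[K]_s) : 'rV[K]_N :=
  \row_j ('X_[M j] : {mpoly K[s]}).@[x 0].

End Veronese.

Section Codes.

Variables (K : finFieldType) (m : nat).

Definition linear_code (C : {set 'rV[K]_m}) : Prop := submod_closed C.

Definition dual_code (C : {set 'rV[K]_m}) : {set 'rV[K]_m} :=
  [set b : 'rV[K]_m | [forall c in C, \sum_i b 0 i * c 0 i == 0]].

Definition scale_code (l : 'rV[K]_m) (C : {set 'rV[K]_m}) : {set 'rV[K]_m} :=
  [set \row_i (l 0 i * a 0 i) | a : 'rV[K]_m in C].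

Definition equivalent_codes (C C' : {set 'rV[K]_m}) : Prop :=
  [/\ linear_code C, linear_code C' &
      exists2 mu : 'rV[K]_m,
        forall i, mu 0 i != 0 & C' = scale_code mu C].

(* As usual for graded pieces, the predicate d.-homog contains 0. *)
Definition rm_code (n : nat) (P : 'I_m -> 'rV[K]_n) (d : nat) :
    {set 'rV[K]_m} :=
  [set c : 'rV[K]_m | `[< exists2 g : {mpoly K[n]},
                 g \is d.-homog & c = \row_i g.@[P i 0] >]].

Definition rm_code_over (n : nat) (Q : 'I_m -> 'rV[K]_n)
    (f : 'I_m -> {mpoly K[n]}) (d : nat) : {set 'rV[K]_m} :=
  [set c : 'rV[K]_m | `[< exists2 g : {mpoly K[n]},
                 g \is d.-homog &
                 c = \row_i (g.@[Q i 0] / (f i).@[Q i 0]) >]].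

End Codes.

(* Main.v *)
(** The k-th Veronese map identifies degree-d forms on its image with degree-kd
    forms on the source: composing a degree-d form with the monomials of degree
    k gives a form of degree kd, and conversely every monomial of degree kd is a
    product of d monomials of degree k. Hence the code on the image is the code
    on X rescaled by the inverses of f_i(Q_i), and dualizing a rescaled code
    inverts the scaling vector. *)

Require Import Defs.
From HB Require Import structures.
From mathcomp Require Import all_boot all_order all_algebra.
From mathcomp Require Import boolp.
From mathcomp Require Import mpoly.

Set Implicit Arguments.
Unset Strict Implicit.
Unset Printing Implicit Defensive.

Import GRing.Theory.
Local Open Scope ring_scope.

Section ScaledCodes.

Variables (K : finFieldType) (m : nat).
Implicit Types (l a b : 'rV[K]_m) (C : {set 'rV[K]_m}).

Lemma dual_codeP C b :
  reflect (forall c, c \in C -> \sum_i b 0 i * c 0 i = 0) (b \in dual_code C).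
Proof.
rewrite inE; apply: (iffP forall_inP) => bC c cC; first exact/eqP/bC.
exact/eqP/bC.
Qed.

Lemma dual_code_linear C : linear_code (dual_code C).
Proof.
split=> [|a x y /dual_codeP xC /dual_codeP yC].
  by apply/dual_codeP => c _; rewrite big1 // => i _; rewrite mxE mul0r.
apply/dual_codeP => c cC.
transitivity (a * (\sum_i x 0 i * c 0 i) + \sum_i y 0 i * c 0 i).
  rewrite mulr_sumr -big_split; apply: eq_bigr => i _ /=.
  by rewrite !mxE mulrDl mulrA.
by rewrite xC // yC // mulr0 addr0.
Qed.

Lemma scale_codeK l l' C : (forall i, l' 0 i * l 0 i = 1) ->
  scale_code l' (scale_code l C) = C.
Proof.
move=> ll'; rewrite /scale_code -imset_comp -[RHS]imset_id.
apply: eq_imset => a /=; apply/rowP => i.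
by rewrite !mxE mulrA ll' mul1r.
Qed.

(** A diagonal scaling is self-adjoint for the standard pairing: pairing [b] with [l'] times [c]
    equals pairing [l'] times [b] with [c]. So [b] is orthogonal to the scaled code exactly when
    [l'] times [b] lies in the dual of [C], and multiplying by [l] recovers [b]. *)
Lemma dual_scale_code l l' C : (forall i, l' 0 i * l 0 i = 1) ->
  dual_code (scale_code l' C) = scale_code l (dual_code C).
Proof.
move=> ll'; apply/setP => b; apply/dual_codeP/imsetP
  => [bC|[a /dual_codeP aC ->] _ /imsetP[c cC ->]].
  exists (\row_i (l' 0 i * b 0 i)).
    apply/dual_codeP => c cC; rewrite -[RHS](bC (\row_i (l' 0 i * c 0 i))).
      by apply: eq_bigr => i _; rewrite !mxE mulrCA mulrA.
    exact: imset_f.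
  by apply/rowP => i; rewrite !mxE mulrA [l 0 i * _]mulrC ll' mul1r.
rewrite -[RHS](aC c cC); apply: eq_bigr => i _.
by rewrite !mxE mulrACA [l 0 i * _]mulrC ll' mul1r.
Qed.

End ScaledCodes.

Section VeroneseForms.

Variables (K : finFieldType) (s N k : nat) (M : 'I_N -> 'X_{1..s}).

(** While [e] is below the degree of [u], the cofactor [w] is nontrivial, so one of its variables
    can be moved over to [v]. *)
Lemma submonomial_of_degree (u : 'X_{1..s}) (e : nat) : (e <= mdeg u)%N ->
  exists v w, u = (v + w)%MM /\ mdeg v = e.
Proof.
elim: e => [_|e IHe lt_eu].
  by exists 0%MM, u; rewrite add0m mdeg0.
have [v [w [uE vE]]] := IHe (ltnW lt_eu).
have : w != 0%MM by apply: contraTneq lt_eu => w0; rewrite uE w0 addm0 vE ltnn.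
rewrite -mdeg_eq0 mdegE sum_nat_eq0 negb_forall => /existsP[i wi].
exists (v + U_(i))%MM, (w - U_(i))%MM; split; last first.
  by rewrite mdegD mdeg1 vE addn1.
rewrite uE -addmA; congr (_ + _)%MM; apply/mnmP => j.
rewrite mnmDE mnmBE mnm1E; case: eqP => [<-|_]; last by rewrite add0n subn0.
by rewrite subnKC // lt0n.
Qed.

(** Divisors of degree [k] are split off [u] one at a time; each is some [M j] and contributes the
    variable of index [j] to [w]. *)
Lemma monomial_factors_through_veronese (d : nat) (u : 'X_{1..s}) :
    (forall v, mdeg v = k -> exists j, M j = v) -> mdeg u = (k * d)%N ->
  exists2 w : 'X_{1..N}, mdeg w = d &
    forall x : 'rV[K]_s, 'X_[w].@[veronese M x 0] = 'X_[u].@[x 0] :> K.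
Proof.
move=> surjM; elim: d u => [|d IHd] u degu.
  exists 0%MM; first exact: mdeg0.
  have /eqP : mdeg u = 0%N by rewrite degu muln0.
  by rewrite mdeg_eq0 => /eqP-> x; rewrite !mpolyX0 !meval1.
have le_ku : (k <= mdeg u)%N by rewrite degu mulnS leq_addr.
have [v [u' [uE degv]]] := submonomial_of_degree le_ku.
have [w degw wE] : exists2 w : 'X_{1..N}, mdeg w = d &
    forall x : 'rV[K]_s, 'X_[w].@[veronese M x 0] = 'X_[u'].@[x 0] :> K.
  by apply: IHd; apply: (@addnI k); rewrite -mulnS -degu uE mdegD degv.
have [j Mj] := surjM v degv.
exists (U_(j) + w)%MM => [|x]; first by rewrite mdegD mdeg1 degw.
by rewrite uE !mpolyXD !mevalM wE mevalXU mxE Mj.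
Qed.

Lemma veronese_pullback (d : nat) (h : {mpoly K[N]}) :
    (forall j, mdeg (M j) = k) -> h \is d.-homog ->
  exists2 g : {mpoly K[s]}, g \is (k * d).-homog &
    forall x : 'rV[K]_s, g.@[x 0] = h.@[veronese M x 0].
Proof.
move=> degM /dhomogP hd.
have {}hd w : w \in msupp h -> mdeg w = d := hd w.
(* The witness is [h] with the monomial [M j] substituted for its [j]-th variable. *)
exists (\sum_(w <- msupp h) h@_w *: \prod_j 'X_[M j] ^+ w j) => [|x].
  rewrite big_seq; apply: rpred_sum => w /hd <-; apply: rpredZ.
  rewrite mdegE big_distrr /=.
  (* The degree, now a sum of the [k * w j], and the product are built up in parallel: the factor
     ['X_[M j] ^+ w j] has degree [k * w j]. *)
  elim/big_rec2: _ => [|j e g _ ge]; first exact: dhomog1.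
  by apply: dhomogM ge; apply: dhomogMn; rewrite dhomogX; apply/eqP/degM.
rewrite raddf_sum [in RHS]mevalE; apply: eq_bigr => w _ /=.
rewrite mevalZ rmorph_prod; congr (_ * _); apply: eq_bigr => j _.
by rewrite rmorphXn /= mxE.
Qed.

(** By linearity it suffices to lift each monomial in the support of [g], all of which have degree
    [k * d]. *)
Lemma veronese_pullback_surj (d : nat) (g : {mpoly K[s]}) :
    (forall v, mdeg v = k -> exists j, M j = v) -> g \is (k * d).-homog ->
  exists2 h : {mpoly K[N]}, h \is d.-homog &
    forall x : 'rV[K]_s, h.@[veronese M x 0] = g.@[x 0].
Proof.
move=> surjM /dhomogP gd; rewrite [g]mpolyE big_seq.
elim/big_rec: _ => [|u p /gd degu [h hd hE]].
  by exists 0 => [|x]; rewrite ?rpred0 // !meval0.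
have [w degw wE] := monomial_factors_through_veronese surjM degu.
exists (g@_u *: 'X_[w] + h) => [|x].
  by rewrite rpredD // rpredZ // dhomogX; apply/eqP.
by rewrite !mevalD !mevalZ wE hE.
Qed.

Lemma rm_code_over_veronese (m d : nat) (P : 'I_m -> 'rV[K]_s)
    (f : 'I_m -> {mpoly K[N]}) : enumerates_monomials k M ->
  rm_code_over (fun i => veronese M (P i)) f d =
  scale_code (\row_i ((f i).@[veronese M (P i) 0])^-1) (rm_code P (k * d)).
Proof.
case=> _ MP; have degM j : mdeg (M j) = k by apply/MP; exists j.
have surjM v : mdeg v = k -> exists j, M j = v by move/MP.
apply/setP => c; rewrite inE; apply/asboolP/imsetP.
  case=> h /(veronese_pullback degM)[g gd gE] ->.
  exists (\row_i g.@[P i 0]); first by rewrite inE; apply/asboolP; exists g.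
  by apply/rowP => i; rewrite !mxE gE mulrC.
case=> a; rewrite inE => /asboolP[g gd ->] ->.
have [h hd hE] := veronese_pullback_surj surjM gd.
by exists h => //; apply/rowP => i; rewrite !mxE hE mulrC.
Qed.

End VeroneseForms.

Theorem theorem3p5 (K : finFieldType) (s m k d N : nat)
    (X : {set {set 'rV[K]_s}}) (P : 'I_m -> 'rV[K]_s)
    (M : 'I_N -> 'X_{1..s}) (f : 'I_m -> {mpoly K[N]})
    (s_ge1 : (1 <= s)%N)
    (X_sub : X \subset proj_space K s)
    (X_neq0 : X != set0)
    (X_card : #|X| = m)
    (X_points : X = [set proj_point (P i) | i : 'I_m])
    (P_normalized : forall i, first_nonzero_entry_is_one (P i))
    (k_ge1 : (1 <= k)%N) (d_ge1 : (1 <= d)%N)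
    (N_def : N = 'C(k + s - 1, s - 1)%N)
    (M_monomials : enumerates_monomials k M)
    (f_homog : forall i, f i \is d.-homog)
    (f_neq0 : forall i, (f i).@[veronese M (P i) 0] != 0) :
  let Q i := veronese M (P i) in
  let C_X := rm_code P (k * d)%N in
  let C_rho := rm_code_over Q f d in
  let lambda := \row_i (f i).@[Q i 0] in
  equivalent_codes (dual_code C_rho) (dual_code C_X) /\
  dual_code C_rho = scale_code lambda (dual_code C_X).
Proof.
move=> Q C_X C_rho lambda.
pose lambdaV : 'rV[K]_m := \row_i ((f i).@[Q i 0])^-1.
have lambdaK i : lambdaV 0 i * lambda 0 i = 1 by rewrite !mxE mulVf ?f_neq0.
have dualE : dual_code C_rho = scale_code lambda (dual_code C_X).
  rewrite /C_rho (rm_code_over_veronese _ _ _ M_monomials).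
  exact: dual_scale_code.
split=> //; split; first exact: dual_code_linear.
  exact: dual_code_linear.
(* Equivalence asks for the second code as a multiple of the first, hence the inverse of
   [lambda]. *)
exists lambdaV => [i|]; first by rewrite mxE invr_neq0 ?f_neq0.
by rewrite dualE scale_codeK.
Qed.
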